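(* Let $(\Omega,\mathcal{H},\hat{\mathbb{E}})$ be a sub-linear expectation space with capacities $(\mathbb{V},\mathcal{V})$ and conjugate expectation $\hat{\varepsilon}[\cdot]$, and let $\{X_n,n\geq1\}\subset\mathcal{H}$ be a sequence of extended negatively dependent (END) random variables. If $\lim_{c\to\infty}\sup_{i\geq1}\hat{\mathbb{E}}[(|X_i|-c)_+]=0$, then for any real number $\varepsilon>0$, $$\mathbb{V}\left(\left\{\frac{\sum_{i=1}^{n}(X_i-\hat{\varepsilon}[X_i])}{n}<-\varepsilon\right\}\bigcup\left\{\frac{\sum_{i=1}^{n}(X_i-\hat{\mathbb{E}}[X_i])}{n}>\varepsilon\right\}\right)\to0\quad\text{as }n\to\infty.$$ Moreover, if in addition $\hat{\mathbb{E}}[X_n]=\bar{\mu}$ and $\hat{\varepsilon}[X_n]=\underline{\mu}$ for all $n\geq1$, with $\bar\mu,\underline\mu$ constants not depending on $n$, then for any $\varepsilon>0$, $$\mathcal{V}\left(\underline{\mu}-\varepsilon\leq\frac{\sum_{i=1}^{n}X_i}{n}\leq\bar{\mu}+\varepsilon\right)\to1\quad\text{as }n\to\infty.$$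
   Context: Setting. $(\Omega,\mathcal{F})$ is a measurable space and $\mathcal{H}$ is a linear space of real functions on $(\Omega,\mathcal{F})$ (called random variables) such that $X_1,\dots,X_n\in\mathcal{H}$ implies $\varphi(X_1,\dots,X_n)\in\mathcal{H}$ for each $\varphi\in C_{l,Lip}(\mathbb{R}^n)$, where $C_{l,Lip}(\mathbb{R}^n)$ is the space of functions $\varphi$ with $|\varphi(x)-\varphi(y)|\leq C(1+|x|^m+|y|^m)|x-y|$ for all $x,y\in\mathbb{R}^n$, for some $C>0$, $m\in\mathbb{N}$ depending on $\varphi$. $C_{b,Lip}(\mathbb{R}^n)$ is the space of functions with $|\varphi(x)|\leq C$ and $|\varphi(x)-\varphi(y)|\leq C|x-y|$ for all $x,y$, for some $C>0$ depending on $\varphi$. Sub-linear expectation. $\hat{\mathbb{E}}:\mathcal{H}\to[-\infty,+\infty]$ satisfies, for all $X,Y\in\mathcal{H}$: (a) $X\geq Y$ implies $\hat{\mathbb{E}}[X]\geq\hat{\mathbb{E}}[Y]$; (b) $\hat{\mathbb{E}}[c]=c$ for constants $c$; (c) $\hat{\mathbb{E}}[X+Y]\leq\hat{\mathbb{E}}[X]+\hat{\mathbb{E}}[Y]$ whenever the right side is not of the form $+\infty-\infty$ or $-\infty+\infty$; (d) $\hat{\mathbb{E}}[\lambda X]=\lambda\hat{\mathbb{E}}[X]$ for $\lambda>0$. The triple $(\Omega,\mathcal{H},\hat{\mathbb{E}})$ is a sub-linear expectation space. The conjugate expectation is $\hat{\varepsilon}[X]:=-\hat{\mathbb{E}}[-X]$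 (not to be confused with the real number $\varepsilon$). Capacities. For $A\in\mathcal{F}$, $\mathbb{V}(A)=\inf\{\hat{\mathbb{E}}[\xi]: I_A\leq\xi,\ \xi\in\mathcal{H}\}$ and $\mathcal{V}(A)=1-\mathbb{V}(A^c)$, where $I_A$ is the indicator function of $A$ and $A^c$ its complement. Extended negative dependence. A sequence $\{X_n,n\geq1\}\subset\mathcal{H}$ is upper (resp. lower) extended negatively dependent if there is a dominating constant $K\geq1$ such that $\hat{\mathbb{E}}\left[\prod_{i=1}^{n}f_i(X_i)\right]\leq K\prod_{i=1}^{n}\hat{\mathbb{E}}[f_i(X_i)]$ for all $n\geq1$, whenever the non-negative functions $f_i\in C_{b,Lip}(\mathbb{R})$, $i=1,2,\dots$, are all non-decreasing (resp. all non-increasing). The sequence is END if it is both upper and lower extended negatively dependent. Notation: $x_+=x$ if $x>0$ and $x_+=0$ otherwise. *)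

(* Defs.v *)
From HB Require Import structures.
From mathcomp Require Import all_boot all_order all_algebra.
From mathcomp Require Import all_classical all_reals all_analysis.

Set Implicit Arguments.
Unset Strict Implicit.
Unset Printing Implicit Defensive.

Import Order.TTheory GRing.Theory Num.Theory.
Import numFieldNormedType.Exports.

Local Open Scope classical_set_scope.
Local Open Scope ring_scope.

(* The library norm on 'rV[R]_n is the sup norm, hence this definition. *)
Definition enorm (R : realType) (n : nat) (x : 'rV[R]_n) : R :=
  Num.sqrt (\sum_(i < n) x 0 i ^+ 2).

Definition C_lLip (R : realType) (n : nat) (phi : 'rV[R]_n -> R) : Prop :=
  exists (C : R) (m : nat), 0 < C /\
    forall x y : 'rV[R]_n,
      `|phi x - phi y| <= C * (1 + enorm x ^+ m + enorm y ^+ m) * enorm (x - y).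

Definition C_bLip (R : realType) (f : R -> R) : Prop :=
  exists C : R, 0 < C /\
    (forall x, `|f x| <= C) /\ (forall x y, `|f x - f y| <= C * `|x - y|).

(* [Ehat] is a total function for convenience; only its values on [rv] are
   constrained. *)
Record sublinear_expectation_space (R : realType) (d : measure_display)
    (Omega : measurableType d) := SublinearExpectationSpace {
  rv : set (Omega -> R);
  rv_zero : rv (fun=> 0);
  rv_add : forall X Y, rv X -> rv Y -> rv (fun w => X w + Y w);
  rv_scale : forall (a : R) X, rv X -> rv (fun w => a * X w);
  rv_comp : forall (n : nat) (X : 'I_n -> Omega -> R) (phi : 'rV[R]_n -> R),
    (0 < n)%N -> (forall i, rv (X i)) -> C_lLip phi ->
    rv (fun w => phi (\row_i X i w));
  Ehat : (Omega -> R) -> \bar R;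
  Ehat_mono : forall X Y, rv X -> rv Y ->
    (forall w, Y w <= X w) -> (Ehat Y <= Ehat X)%E;
  Ehat_cst : forall c : R, Ehat (fun=> c) = c%:E;
  Ehat_subadd : forall X Y, rv X -> rv Y -> (Ehat X +? Ehat Y)%E ->
    (Ehat (fun w => X w + Y w)%R <= Ehat X + Ehat Y)%E;
  Ehat_scale : forall (l : R) X, 0 < l -> rv X ->
    Ehat (fun w => l * X w)%R = (l%:E * Ehat X)%E
}.

Section SublinearExpectation.
Context {R : realType} {d : measure_display} {Omega : measurableType d}.
Variable S : sublinear_expectation_space R Omega.

Definition conj_expectation (X : Omega -> R) : \bar R :=
  (- Ehat S (fun w => - X w)%R)%E.

(* The defining formula makes sense for every subset of [Omega], so [A] is not
   required to be measurable. *)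
Definition upper_capacity (A : set Omega) : \bar R :=
  ereal_inf [set Ehat S xi | xi in
    [set xi | rv S xi /\ forall w, \1_A w <= xi w]].

Definition lower_capacity (A : set Omega) : \bar R :=
  (1 - upper_capacity (~` A))%E.

(* Sequences are indexed from 0: [X i] stands for X_{i+1}. *)
Definition END_with (monotone : (R -> R) -> Prop) (X : nat -> Omega -> R) :
    Prop :=
  exists K : R, 1 <= K /\
    forall f : nat -> R -> R,
      (forall i, C_bLip (f i)) -> (forall i x, 0 <= f i x) ->
      (forall i, monotone (f i)) ->
      forall n : nat, (1 <= n)%N ->
      (Ehat S (fun w => \prod_(i < n) f i (X i w))%R
        <= K%:E * \prod_(i < n) Ehat S (fun w => f i (X i w)))%E.

Definition upper_END (X : nat -> Omega -> R) : Prop :=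
  END_with (fun f => {homo f : x y / x <= y}) X.

Definition lower_END (X : nat -> Omega -> R) : Prop :=
  END_with (fun f => {homo f : x y /~ x <= y}) X.

Definition extended_negatively_dependent (X : nat -> Omega -> R) : Prop :=
  upper_END X /\ lower_END X.

End SublinearExpectation.

(* Main.v *)
(* Let [Y_i] be [X_i] truncated to [[-c, c]]. By uniform integrability and
   Markov's inequality, replacing [X_i] by [Y_i] costs an arbitrarily small
   capacity once [c] is large. For [Y_i], exponential moments are not needed: for
   small [t > 0] the affine factors [1 + t (Y_i - E[Y_i])] are nonnegative,
   increasing in [X_i] and have sublinear expectation at most [1], so upper
   extended negative dependence bounds the expectation of their product by [K].
   On the event that the [n] centred terms sum to at least [n eta], the
   product is at least [exp (n kappa)] for some fixed [kappa > 0], and Markov's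
   inequality makes the capacity of that event at most [K / (1 + n kappa)]. The
   lower tail is the upper tail of [- X_i], which is upper extended negatively
   dependent because [X_i] is lower extended negatively dependent. *)
Require Import Defs.
From HB Require Import structures.
From mathcomp Require Import all_boot all_order all_algebra.
From mathcomp Require Import all_classical all_reals all_analysis.
From mathcomp Require Import ring lra.
Set Implicit Arguments.
Unset Strict Implicit.
Unset Printing Implicit Defensive.
Import Order.TTheory GRing.Theory Num.Theory.
Import numFieldNormedType.Exports.
Local Open Scope classical_set_scope.
Local Open Scope ring_scope.

(** * Local Lipschitz bounds in the Euclidean norm *)

Section EuclideanNorm.
Context {R : realType}.

Lemma normr_le_enorm (n : nat) (x : 'rV[R]_n) (i : 'I_n) : `|x 0 i| <= enorm x.
Proof.
rewrite -sqrtr_sqr ler_sqrt; last by apply: sumr_ge0 => j _; rewrite sqr_ge0.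
by rewrite (bigD1 i) //= lerDl sumr_ge0 // => j _; rewrite sqr_ge0.
Qed.

Lemma C_lLip_coord (n : nat) (f : R -> R) (C : R) (i : 'I_n) : 0 < C ->
  (forall x y, `|f x - f y| <= C * `|x - y|) ->
  C_lLip (fun v : 'rV[R]_n => f (v 0 i)).
Proof.
move=> C0 fC; exists C, 0%N; split => // x y.
apply: le_trans (fC _ _) _; have := normr_le_enorm (x - y) i.
rewrite !mxE !expr0; have := normr_ge0 (x 0 i - y 0 i).
by move=> ? ?; rewrite -mulrA ler_pM2l //; nra.
Qed.

(** The product is not globally Lipschitz; the growth exponent [m = 1] absorbs the unbounded factors
    [x 0 0] and [y 0 1]. This yields closure of [rv] under products. *)
Lemma C_lLip_mul : C_lLip (fun v : 'rV[R]_2 => v 0 0 * v 0 1).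
Proof.
exists 1, 1%N; split => // x y; rewrite !expr1 mul1r.
have -> : x 0 0 * x 0 1 - y 0 0 * y 0 1 =
    x 0 0 * (x - y) 0 1 + y 0 1 * (x - y) 0 0 by rewrite !mxE; ring.
apply: le_trans (ler_normD _ _) _; rewrite !normrM.
have := normr_le_enorm x 0; have := normr_le_enorm y 1.
have := normr_le_enorm (x - y) 0; have := normr_le_enorm (x - y) 1.
have := normr_ge0 (x 0 0); have := normr_ge0 (y 0 1).
have := normr_ge0 ((x - y) 0 0); have := normr_ge0 ((x - y) 0 1).
move: `|x 0 0| `|y 0 1| `|(x - y) 0 0| `|(x - y) 0 1| (enorm x) (enorm y) (enorm _).
move=> a b p q A B D p0 q0 b0 a0 qD pD bB aA.
have := ler_pM a0 p0 aA qD; have := ler_pM b0 q0 bB pD.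
by rewrite !mulrDl mul1r; lra.
Qed.

End EuclideanNorm.

(** * Truncation at level [c] and its error *)

Section Truncation.
Context {R : realType}.
Implicit Types x y c : R.

Definition excess c x := Num.max (`|x| - c) 0.

Definition clip c x := Num.max (- c) (Num.min x c).

Lemma excess_ge0 c x : 0 <= excess c x.
Proof. by rewrite le_max lexx orbT. Qed.

Lemma excessN c x : excess c (- x) = excess c x.
Proof. by rewrite /excess normrN. Qed.

Lemma excess_lip c x y : `|excess c x - excess c y| <= 1 * `|x - y|.
Proof.
rewrite mul1r; have := ler_dist_dist x y; rewrite /excess /Num.max.
by rewrite !ler_norml; case: ifPn; case: ifPn; rewrite -?leNgt; lra.
Qed.

Lemma clip_bound c x : 0 <= c -> `|clip c x| <= c.
Proof.
rewrite /clip /Num.max /Num.min ler_norml => c0.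
by case: ifPn; case: ifPn; rewrite -?leNgt; lra.
Qed.

Lemma clip_homo c : {homo clip c : x y / x <= y}.
Proof.
move=> x y xy; rewrite /clip /Num.max /Num.min.
by do ![case: ifPn]; rewrite -?leNgt; lra.
Qed.

Lemma clip_lip c x y : 0 <= c -> `|clip c x - clip c y| <= 1 * `|x - y|.
Proof.
rewrite mul1r => c0.
have := ler_norm (x - y); have := ler_norm (y - x); rewrite distrC ler_norml.
rewrite /clip /Num.max /Num.min.
by do ![case: ifPn]; rewrite -?leNgt; lra.
Qed.

Lemma clip_excess c x : 0 <= c -> `|x - clip c x| <= excess c x.
Proof.
move=> c0; have := ler_norm x; have := ler_norm (- x); rewrite normrN ler_norml.
rewrite /excess /clip /Num.max /Num.min.
by do ![case: ifPn]; rewrite -?leNgt; lra.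
Qed.

End Truncation.

(* From [1 / (1 + a) <= 1 - a + 2 a^2 <= exp (- a + 2 a^2)]. *)
Lemma expR_le1Dx {R : realType} (a : R) : `|a| <= 2^-1 ->
  expR (a - 2 * a ^+ 2) <= 1 + a.
Proof.
rewrite ler_norml => /andP[al au].
have a1 : 0 < 1 + a by lra.
have e : 1 <= (1 + a) * expR (- (a - 2 * a ^+ 2)).
  apply: (@le_trans _ _ ((1 + a) * (1 + - (a - 2 * a ^+ 2)))).
    by have := sqr_ge0 a; nra.
  by rewrite ler_pM2l // expR_ge1Dx.
by move: e; rewrite expRN ler_pdivlMr ?expR_gt0 // mul1r.
Qed.

(** Each factor is bounded below by an exponential, the exponents add up, and [expR u >= 1 + u]
    returns to a linear bound. The quadratic losses total at most [n * (2 * b ^+ 2)]. *)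
Lemma sum_le_prod {R : realType} (n : nat) (a : 'I_n -> R) (b s : R) :
  b <= 2^-1 -> (forall i, `|a i| <= b) -> s <= \sum_(i < n) a i ->
  1 + (s - n%:R * (2 * b ^+ 2)) <= \prod_(i < n) (1 + a i).
Proof.
move=> b2 ab sa.
apply: (@le_trans _ _ (\prod_(i < n) expR (a i - 2 * a i ^+ 2))).
  rewrite -expR_sum; apply: le_trans (expR_ge1Dx _).
  rewrite lerD2l sumrB lerB //.
  apply: (@le_trans _ _ (\sum_(i < n) 2 * b ^+ 2)); last first.
    by rewrite sumr_const card_ord -[leLHS]mulr_natl.
  apply: ler_sum => i _.
  rewrite ler_pM2l // -real_normK ?num_real //.
  apply: lerXn2r => //; rewrite ?nnegrE //; exact: le_trans (ab i).
apply: ler_prod => i _; rewrite expR_ge0 expR_le1Dx //.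
exact: le_trans (ab i) b2.
Qed.

(** * Closure of the space of random variables and elementary bounds on expectations *)

Section SublinearExpectation.
Context {R : realType} {d : measure_display} {Omega : measurableType d}.
Variable S : sublinear_expectation_space R Omega.
Implicit Types (X Y xi : Omega -> R) (a b c : R).

Lemma rv_lip (f : R -> R) (C : R) X : 0 < C ->
  (forall x y, `|f x - f y| <= C * `|x - y|) -> rv S X ->
  rv S (fun w => f (X w)).
Proof.
move=> C0 fC XS; have := @rv_comp _ _ _ S 1 (fun=> X) _ isT (fun=> XS)
  (C_lLip_coord ord0 C0 fC).
by congr (rv S _); apply/funext => w; rewrite mxE.
Qed.

Lemma rv_cst c : rv S (fun=> c).
Proof.
by apply: (@rv_lip (fun=> c) 1 (fun=> 0)) => // [x y|];
  [rewrite subrr normr0 mul1r|exact: rv_zero].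
Qed.

Lemma rv_opp X : rv S X -> rv S (fun w => - X w).
Proof.
by move=> /(rv_scale (-1)); congr (rv S _); apply/funext => w; rewrite mulN1r.
Qed.

Lemma rv_mul X Y : rv S X -> rv S Y -> rv S (fun w => X w * Y w).
Proof.
move=> XS YS; pose Z (i : 'I_2) := if i == 0 then X else Y.
have ZS i : rv S (Z i) by rewrite /Z; case: ifP.
have := @rv_comp _ _ _ S 2 Z _ isT ZS C_lLip_mul.
by congr (rv S _); apply/funext => w; rewrite !mxE.
Qed.

Lemma rv_sum (X : nat -> Omega -> R) n : (forall i, rv S (X i)) ->
  rv S (fun w => \sum_(i < n) X i w).
Proof.
move=> XS; elim: n => [|n IH].
  by under eq_fun do rewrite big_ord0; exact: rv_zero.
by under eq_fun do rewrite big_ord_recr /=; exact: rv_add.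
Qed.

Lemma rv_prod (X : nat -> Omega -> R) n : (forall i, rv S (X i)) ->
  rv S (fun w => \prod_(i < n) X i w).
Proof.
move=> XS; elim: n => [|n IH].
  by under eq_fun do rewrite big_ord0; exact: rv_cst.
by under eq_fun do rewrite big_ord_recr /=; exact: rv_mul.
Qed.

Lemma Ehat_ge0 X : rv S X -> (forall w, 0 <= X w) -> (0 <= Ehat S X)%E.
Proof.
move=> XS X0; apply: (@le_trans _ _ (Ehat S (fun=> 0))); first by rewrite Ehat_cst.
by apply: Ehat_mono => //; exact: rv_cst.
Qed.

(* Real upper bounds exclude the undefined sums of infinities in [Ehat_subadd]. *)
Lemma Ehat_add_le X Y a b : rv S X -> rv S Y ->
  (Ehat S X <= a%:E)%E -> (Ehat S Y <= b%:E)%E ->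
  (Ehat S (fun w => X w + Y w)%R <= (a + b)%:E)%E.
Proof.
move=> XS YS Xa Yb; apply: (@le_trans _ _ (Ehat S X + Ehat S Y)%E).
  apply: Ehat_subadd => //.
  by move: Xa Yb; case: (Ehat S X) => [x||]; case: (Ehat S Y).
by rewrite EFinD leeD.
Qed.

Lemma Ehat_scale_le X l a : 0 < l -> rv S X -> (Ehat S X <= a%:E)%E ->
  (Ehat S (fun w => l * X w)%R <= (l * a)%:E)%E.
Proof. by move=> l0 XS Xa; rewrite Ehat_scale // EFinM lee_pmul2l. Qed.

Lemma Ehat_sum_le (X : nat -> Omega -> R) a n : (forall i, rv S (X i)) ->
  (forall i, Ehat S (X i) <= a%:E)%E ->
  (Ehat S (fun w => \sum_(i < n) X i w)%R <= (n%:R * a)%:E)%E.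
Proof.
move=> XS Xa; elim: n => [|n IH].
  by under eq_fun do rewrite big_ord0; rewrite mul0r Ehat_cst.
under eq_fun do rewrite big_ord_recr /=.
rewrite -addn1 natrD mulrDl mul1r; apply: Ehat_add_le => //; exact: rv_sum.
Qed.

Lemma rv_excess c X : rv S X -> rv S (fun w => excess c (X w)).
Proof. by move=> XS; apply: (rv_lip ltr01 (excess_lip c)). Qed.

Lemma rv_clip c X : 0 <= c -> rv S X -> rv S (fun w => clip c (X w)).
Proof. by move=> c0 XS; apply: (rv_lip ltr01) => // x y; exact: clip_lip. Qed.

Lemma Ehat_clip_bound c X : 0 <= c -> rv S X ->
  ((- c)%:E <= Ehat S (fun w => clip c (X w)) <= c%:E)%E.
Proof.
move=> c0 XS; have YS := rv_clip c0 XS.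
have cX w : - c <= clip c (X w) <= c by rewrite -ler_norml clip_bound.
rewrite -(Ehat_cst S c) -(Ehat_cst S (- c)); apply/andP.
by split; apply: Ehat_mono => //; (try exact: rv_cst) => w; case/andP: (cX w).
Qed.

(** Subadditivity on [X + (- X) = 0] gives [0 <= E[X] + E[- X]]; as both terms are bounded above,
    neither can be [-oo]. *)
Lemma Ehat_fin_num X b : rv S X ->
  (Ehat S X <= b%:E)%E -> (Ehat S (fun w => - X w)%R <= b%:E)%E ->
  Ehat S X \is a fin_num.
Proof.
move=> XS Xb NXb.
have : (Ehat S (fun w => X w + - X w)%R <= Ehat S X + Ehat S (fun w => - X w)%R)%E.
  apply: Ehat_subadd => //; first exact: rv_opp.
  by move: Xb NXb; case: (Ehat S X) => [x||]; case: (Ehat S _).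
under eq_fun do rewrite subrr.
by rewrite Ehat_cst; move: Xb NXb; case: (Ehat S X) => [x||]; case: (Ehat S _).
Qed.

(** Both [X] and [- X] are at most [excess c X + c], so both have expectations bounded above. *)
Lemma Ehat_excess_fin_num X c b : 0 <= c -> rv S X ->
  (Ehat S (fun w => excess c (X w)) <= b%:E)%E -> Ehat S X \is a fin_num.
Proof.
move=> c0 XS Xb.
have h Y : rv S Y -> (Ehat S (fun w => excess c (Y w)) <= b%:E)%E ->
    (Ehat S Y <= (b + c)%:E)%E.
  move=> YS Yb; apply: (@le_trans _ _ (Ehat S (fun w => excess c (Y w) + c))).
    apply: Ehat_mono => // [|w].
      by apply: rv_add; [exact: rv_excess|exact: rv_cst].
    have := ler_norm (Y w); rewrite /excess /Num.max; case: ifPn; rewrite -?leNgt; lra.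
  apply: Ehat_add_le => //; [exact: rv_excess|exact: rv_cst|by rewrite Ehat_cst].
apply: (@Ehat_fin_num _ (b + c)) => //; first exact: h.
by apply: h; [exact: rv_opp|under eq_fun do rewrite excessN].
Qed.

(** * Extended negative dependence and the upper tail of truncated variables *)

Lemma END_with_opp (P Q : (R -> R) -> Prop) (X : nat -> Omega -> R) :
  (forall f, P f -> Q (fun x => f (- x))) ->
  END_with S Q X -> END_with S P (fun i w => - X i w).
Proof.
move=> PQ [K [K1 EK]]; exists K; split => // f fb f0 fP n n1.
apply: (EK (fun i x => f i (- x))) => // i; last exact: PQ.
have [C [C0 [fC fL]]] := fb i; exists C; split=> //; split=> // x y.
by apply: le_trans (fL _ _) _; rewrite -opprD normrN.
Qed.

(** The tail bound is expressed by a majorant [xi] of the indicator of the event, because majorants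
    of several events can later be added. *)
Lemma upper_END_clip_tail (X : nat -> Omega -> R) (c eta delta : R) :
  (forall i, rv S (X i)) -> upper_END S X -> 0 < c -> 0 < eta -> 0 < delta ->
  \forall n \near \oo, exists xi,
    [/\ rv S xi, (forall w, 0 <= xi w), (Ehat S xi <= delta%:E)%E &
      forall w, n%:R * eta <= \sum_(i < n)
        (clip c (X i w) - fine (Ehat S (fun w => clip c (X i w)))) -> 1 <= xi w].
Proof.
move=> XS [K [K1 EK]] c0 eta0 delta0.
have c0' := ltW c0.
pose y i := fine (Ehat S (fun w => clip c (X i w))).
have YS i : rv S (fun w => clip c (X i w)) by exact: rv_clip.
have Yy i : Ehat S (fun w => clip c (X i w)) = (y i)%:E.
  by rewrite /y; case/andP: (Ehat_clip_bound c0' (XS i)); case: (Ehat S _).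
have yc i : `|y i| <= c by rewrite ler_norml -!lee_fin -Yy Ehat_clip_bound.
(* The bound [1 / (4 c)] keeps every factor at least [1/2]; the bound [eta / (16 c^2)] makes the
   quadratic loss [8 t^2 c^2] at most half of the linear gain [t eta]. *)
pose t := Num.min (4 * c)^-1 (eta / (16 * c ^+ 2)).
have t0 : 0 < t by rewrite lt_min !(invr_gt0, divr_gt0, mulr_gt0, exprn_gt0).
have tc : t * (2 * c) <= 2^-1.
  rewrite -ler_pdivlMr ?mulr_gt0 //.
  apply: (@le_trans _ _ (4 * c)^-1); first by rewrite ge_min lexx.
  by rewrite le_eqVlt; apply/orP; left; apply/eqP; field; rewrite gt_eqF.
have tc2 : 2 * (t * (2 * c)) ^+ 2 <= t * eta / 2.
  have : t <= eta / (16 * c ^+ 2) by rewrite ge_min lexx orbT.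
  rewrite ler_pdivlMr ?mulr_gt0 ?exprn_gt0 // => h.
  have := h; rewrite -(ler_pM2l t0); nra.
pose f i x := 1 + t * (clip c x - y i).
have fc i x : `|t * (clip c x - y i)| <= t * (2 * c).
  rewrite normrM gtr0_norm // ler_pM2l //; apply: le_trans (ler_normB _ _) _.
  by have := clip_bound x c0'; have := yc i; lra.
have f0 i x : 0 <= f i x.
  by have := fc i x; rewrite ler_norml /f; lra.
have fb i : C_bLip (f i).
  exists (2 + t); split; first by lra.
  split=> [x|x z].
    rewrite ger0_norm //; have := fc i x; rewrite ler_norml /f; lra.
  have -> : f i x - f i z = t * (clip c x - clip c z) by rewrite /f; ring.
  rewrite normrM gtr0_norm //; have := clip_lip x z c0'; rewrite mul1r.
  by have := normr_ge0 (x - z); have := normr_ge0 (clip c x - clip c z); nra.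
have fh i : {homo f i : x z / x <= z}.
  by move=> x z xz; rewrite /f lerD2l ler_pM2l // lerB // clip_homo.
(* The constant part [1 - t * y i] and [t * E[Y_i] = t * y i] add up to [1]. *)
have Ef i : (Ehat S (fun w => f i (X i w)) <= 1%:E)%E.
  have -> : (1 : R) = (1 - t * y i) + t * y i by ring.
  have -> : (fun w => f i (X i w)) =
      (fun w => (1 - t * y i) + t * clip c (X i w)).
    by apply/funext => w; rewrite /f; ring.
  apply: Ehat_add_le; [exact: rv_cst|exact: rv_scale|by rewrite Ehat_cst|].
  by apply: Ehat_scale_le => //; rewrite Yy.
have fS i : rv S (fun w => f i (X i w)).
  have [C [C0 [_ fL]]] := fb i; exact: (rv_lip C0).
pose kappa := t * eta / 2.
have kappa0 : 0 < kappa by rewrite divr_gt0 // mulr_gt0.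
near=> n.
have n0 : (0 < n)%N by near: n; exact: nbhs_infty_gt.
(* For such [n] the Markov bound [K / (1 + n kappa)] is at most [delta]. *)
have nK : K / delta <= 1 + n%:R * kappa.
  have : K / delta / kappa <= n%:R by near: n; exact: nbhs_infty_ger.
  by rewrite ler_pdivrMr //; lra.
have nk0 : 0 < 1 + n%:R * kappa.
  by rewrite ltr_pwDl // mulr_ge0 // ltW.
exists (fun w => (1 + n%:R * kappa)^-1 * \prod_(i < n) f i (X i w)); split.
- by apply: rv_scale; exact: (rv_prod n fS).
- by move=> w; rewrite mulr_ge0 ?invr_ge0 ?(ltW nk0) // prodr_ge0.
- apply: (@le_trans _ _ ((1 + n%:R * kappa)^-1 * K)%:E); last first.
    by rewrite lee_fin mulrC ler_pdivrMr // mulrC -ler_pdivrMr.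
  apply: Ehat_scale_le; [by rewrite invr_gt0|exact: (rv_prod n fS)|].
  apply: le_trans (EK f fb f0 fh n n0) _.
  rewrite -[leRHS]mule1; apply: lee_wpmul2l.
    by rewrite lee_fin; lra.
  (* Nonnegativity is carried through the induction, since multiplying upper bounds in [\bar R]
     relies on it. *)
  suff /andP[] : (0 <= \prod_(i < n) Ehat S (fun w => f i (X i w)) <= 1)%E by [].
  elim/big_ind : _ => [|u v /andP[u0 u1] /andP[v0 v1]|i _].
  + by rewrite lexx lee01.
  + by rewrite mule_ge0 //= -[leRHS]mule1 lee_pmul.
  + by rewrite Ef Ehat_ge0.
- move=> w Hw; rewrite mulrC ler_pdivlMr // mul1r.
  (* Here [sum_le_prod] has [s = n t eta] and [b = 2 t c]; by [tc2] the loss is at most half of [s],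
     which leaves [n kappa]. *)
  apply: (@le_trans _ _ (1 + (n%:R * (t * eta) - n%:R * (2 * (t * (2 * c)) ^+ 2)))).
    rewrite lerD2l -mulrBr ler_pM2l ?ltr0n // /kappa; lra.
  apply: sum_le_prod => [|i|]; [exact: tc|exact: fc|].
  by rewrite -mulr_sumr mulrCA ler_pM2l.
Unshelve. all: by end_near.
Qed.

(** * Removing the truncation by uniform integrability *)

(** One level [c] per tolerance [b] is enough, since [excess c x] is non-increasing in [c]. *)
Definition uniformly_integrable (X : nat -> Omega -> R) :=
  forall b, 0 < b -> exists2 c, 0 < c &
    forall i, (Ehat S (fun w => excess c (X i w)) <= b%:E)%E.

Lemma uniformly_integrableN (X : nat -> Omega -> R) :
  uniformly_integrable X -> uniformly_integrable (fun i w => - X i w).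
Proof.
move=> ui b /ui[c c0 Xb]; exists c => // i.
by under eq_fun do rewrite excessN.
Qed.

Lemma uniformly_integrable_fin_num (X : nat -> Omega -> R) i :
  (forall i, rv S (X i)) -> uniformly_integrable X ->
  Ehat S (X i) \is a fin_num.
Proof.
move=> XS /(_ 1 ltr01)[c c0 Xb].
exact: Ehat_excess_fin_num (ltW c0) (XS i) (Xb i).
Qed.

(** Termwise [X_i - m_i <= (Y_i - y_i) + Z_i + b], with [Z_i] the excess. If the left side sums to
    at least [n eps] and [b <= eps / 4], then either the [Z_i] sum to at least [n eps / 4] or the
    [Y_i - y_i] to at least [n eps / 2]. *)
Lemma upper_END_tail (X : nat -> Omega -> R) (eps delta : R) :
  (forall i, rv S (X i)) -> upper_END S X -> uniformly_integrable X ->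
  0 < eps -> 0 < delta ->
  \forall n \near \oo, exists xi,
    [/\ rv S xi, (forall w, 0 <= xi w), (Ehat S xi <= delta%:E)%E &
      forall w, n%:R * eps <= \sum_(i < n) (X i w - fine (Ehat S (X i))) ->
        1 <= xi w].
Proof.
move=> XS XE ui eps0 delta0.
(* The first bound controls the shift of the means, the second makes the Markov cost
   [4 / (n eps) * (n b)] at most [delta / 2]. *)
pose b := Num.min (eps / 4) (eps * delta / 8).
have b0 : 0 < b by rewrite lt_min !(divr_gt0, mulr_gt0).
have b_eps : b <= eps / 4 by rewrite ge_min lexx.
have b_delta : b <= eps * delta / 8 by rewrite ge_min lexx orbT.
have [c c0 Xb] := ui b b0; have c0' := ltW c0.
have YS i : rv S (fun w => clip c (X i w)) by exact: rv_clip.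
have ZS i : rv S (fun w => excess c (X i w)) by exact: rv_excess.
pose y i := fine (Ehat S (fun w => clip c (X i w))).
pose m i := fine (Ehat S (X i)).
(* Pointwise [clip c x <= x + excess c x], and subadditivity passes this to the means. *)
have ym i : y i <= m i + b.
  have Xm : Ehat S (X i) = (m i)%:E.
    by rewrite fineK //; exact: uniformly_integrable_fin_num.
  have := @Ehat_add_le (X i) (fun w => excess c (X i w)) (m i) b (XS i) (ZS i).
  rewrite Xm => /(_ (lexx _) (Xb i)) h.
  have {h} : (Ehat S (fun w => clip c (X i w)) <= (m i + b)%:E)%E.
    apply: le_trans h; apply: Ehat_mono => // [|w]; first exact: rv_add.
    by have := clip_excess (X i w) c0'; rewrite ler_norml; lra.
  by rewrite /y; case/andP: (Ehat_clip_bound c0' (XS i)); case: (Ehat S _).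
have eps2 : 0 < eps / 2 by rewrite divr_gt0.
have delta2 : 0 < delta / 2 by rewrite divr_gt0.
have := upper_END_clip_tail XS XE c0 eps2 delta2; have := nbhs_infty_gt 0.
apply: filterS2 => n n0 [xi [xiS xi0 xiE xi1]].
have nr0 : 0 < n%:R :> R by rewrite ltr0n.
have ne0 : 0 < 4 / (n%:R * eps) by rewrite divr_gt0 // mulr_gt0.
have sZ0 w : 0 <= \sum_(i < n) excess c (X i w).
  by apply: sumr_ge0 => i _; exact: excess_ge0.
have sZS := rv_sum n ZS.
(* The first summand is at least [1] when the excesses sum to at least [n eps / 4]; the second
   handles the truncated tail. *)
exists (fun w => 4 / (n%:R * eps) * (\sum_(i < n) excess c (X i w)) + xi w); split.
- by apply: rv_add => //; exact: rv_scale.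
- by move=> w; rewrite addr_ge0 // mulr_ge0 // ltW.
- apply: (@le_trans _ _ (4 / (n%:R * eps) * (n%:R * b) + delta / 2)%:E).
    apply: Ehat_add_le => //; first exact: rv_scale.
    by apply: Ehat_scale_le => //; exact: (Ehat_sum_le n ZS Xb).
  rewrite lee_fin.
  have -> : 4 / (n%:R * eps) * (n%:R * b) = 4 / eps * b.
    by field; rewrite ?gt_eqF.
  have : 4 / eps * b <= 4 / eps * (eps * delta / 8) by rewrite ler_pM2l // divr_gt0.
  have -> : 4 / eps * (eps * delta / 8) = delta / 2 by field; rewrite gt_eqF.
  by lra.
- move=> w Hw.
  have [Zle|Zgt] := lerP (n%:R * (eps / 4)) (\sum_(i < n) excess c (X i w)).
    have : 1 <= 4 / (n%:R * eps) * \sum_(i < n) excess c (X i w).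
      rewrite [leLHS](_ : 1 = 4 / (n%:R * eps) * (n%:R * (eps / 4))).
        by rewrite ler_pM2l.
      by field; rewrite ?gt_eqF.
    by have := xi0 w; lra.
  have : 1 <= xi w.
    apply: xi1.
    have : n%:R * eps <= \sum_(i < n) (X i w - m i) by exact: Hw.
    have : \sum_(i < n) (X i w - m i) <=
        \sum_(i < n) (clip c (X i w) - y i) + \sum_(i < n) excess c (X i w) + n%:R * b.
      rewrite (_ : n%:R * b = \sum_(i < n) b); last first.
        by rewrite sumr_const card_ord mulr_natl.
      rewrite -!big_split /=; apply: ler_sum => i _; have := ym i.
      by have := clip_excess (X i w) c0'; rewrite ler_norml; lra.
    have : n%:R * b <= n%:R * (eps / 4) by rewrite ler_pM2l.
    by rewrite -/(\sum_(i < n) (clip c (X i w) - y i)); lra.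
  by have := mulr_ge0 (ltW ne0) (sZ0 w); lra.
Qed.

(** * Bounds on the upper capacity *)

Lemma upper_capacity_ge0 (A : set Omega) : (0 <= upper_capacity S A)%E.
Proof.
apply: le_ereal_inf_tmp => _ [xi [xiS Axi] <-]; apply: Ehat_ge0 => // w.
by apply: le_trans (Axi w); rewrite indicE ler0n.
Qed.

Lemma upper_capacity_le (A : set Omega) xi : rv S xi -> (forall w, 0 <= xi w) ->
  (forall w, A w -> 1 <= xi w) -> (upper_capacity S A <= Ehat S xi)%E.
Proof.
move=> xiS xi0 xi1; apply: ereal_inf_lbound; exists xi => //.
by split=> // w; rewrite indicE; case: (boolP (w \in A)) => [/set_mem/xi1|].
Qed.

Lemma upper_capacity_mono (A B : set Omega) : A `<=` B ->
  (upper_capacity S A <= upper_capacity S B)%E.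
Proof.
move=> AB; apply: le_ereal_inf_tmp => _ [xi [xiS Bxi] <-].
apply: ereal_inf_lbound; exists xi => //; split=> // w.
apply: le_trans (Bxi w); rewrite !indicE ler_nat.
by case: (boolP (w \in A)) => // /set_mem/AB/mem_set ->.
Qed.

End SublinearExpectation.

(** Eventually [u] is real-valued, so neighbourhoods of [0] reduce to balls of reals; using [e / 2]
    makes the bound strict. *)
Lemma cvge0 {R : realType} {T : Type} (F : set_system T) (u : T -> \bar R) :
  Filter F -> (forall t, 0 <= u t)%E ->
  (forall e : R, 0 < e -> \forall t \near F, (u t <= e%:E)%E) ->
  u t @[t --> F] --> 0%E.
Proof.
move=> FF u0 ue A [/= e e0 eA].
have e2 : 0 < e / 2 by rewrite divr_gt0.
have := ue _ e2; apply: filterS => t.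
move: (u0 t); rewrite /=; case: (u t) => [r||] //; rewrite !lee_fin => r0 re.
apply: eA; rewrite /= sub0r normrN ger0_norm //.
by apply: le_lt_trans re _; rewrite ltr_pdivrMr // ltr_pMr // ltr1n.
Qed.

(** * The weak law and its form for the lower capacity *)

Theorem theorem2p3 (R : realType) (d : measure_display)
    (Omega : measurableType d) (S : sublinear_expectation_space R Omega)
    (X : nat -> Omega -> R)
    (X_rv : forall i, rv S (X i))
    (X_END : extended_negatively_dependent S X)
    (X_ui : ereal_sup
        (range (fun i : nat => Ehat S (fun w => Num.max (`|X i w| - c) 0)))
      @[c --> +oo] --> 0%E) :
  (forall eps : R, 0 < eps ->
    upper_capacity S
      ([set w | ((n%:R^-1)%:E *
                 \sum_(i < n) ((X i w)%:E - conj_expectation S (X i))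
                 < (- eps)%:E)%E] `|`
       [set w | ((n%:R^-1)%:E *
                 \sum_(i < n) ((X i w)%:E - Ehat S (X i))
                 > eps%:E)%E])
      @[n --> \oo] --> 0%E) /\
  (forall mu_up mu_low : R,
    (forall i, Ehat S (X i) = mu_up%:E) ->
    (forall i, conj_expectation S (X i) = mu_low%:E) ->
    forall eps : R, 0 < eps ->
    lower_capacity S
      [set w | mu_low - eps <= (\sum_(i < n) X i w) / n%:R <= mu_up + eps]
      @[n --> \oo] --> 1%E).
Proof.
have ui : uniformly_integrable S X.
  (* The limit puts the supremum below [b] for all large [c]; a positive such [c] serves every [i]
     at once. *)
  move=> b b0; have : pinfty_nbhs R [set c | (ereal_sup
      (range (fun i : nat => Ehat S (fun w => Num.max (`|X i w| - c) 0)%R))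
      < b%:E)%E].
    apply: (X_ui [set x | (x < b%:E)%E]); exact: lt_nbhsl b0.
  move=> /pinfty_ex_gt0[c c0 cb]; exists c => // i; apply: ltW.
  by apply: le_lt_trans cb; apply: ereal_sup_ubound; exists i.
have [XuE XlE] := X_END.
have NX_rv i : rv S (fun w => - X i w) by exact: rv_opp.
have NXuE : upper_END S (fun i w => - X i w).
  apply: END_with_opp XlE => f fh x y xy; apply: fh; by rewrite lerN2.
have Nui := uniformly_integrableN ui.
have Efin i := uniformly_integrable_fin_num i X_rv ui.
have NEfin i := uniformly_integrable_fin_num i NX_rv Nui.
have weak_law (eps : R) : 0 < eps ->
    upper_capacity S
      ([set w | ((n%:R^-1)%:E *
                 \sum_(i < n) ((X i w)%:E - conj_expectation S (X i))
                 < (- eps)%:E)%E] `|`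
       [set w | ((n%:R^-1)%:E *
                 \sum_(i < n) ((X i w)%:E - Ehat S (X i))
                 > eps%:E)%E])
      @[n --> \oo] --> 0%E.
  move=> eps0; apply: cvge0 => [n|delta delta0]; first exact: upper_capacity_ge0.
  have delta2 : 0 < delta / 2 by rewrite divr_gt0.
  have := upper_END_tail NX_rv NXuE Nui eps0 delta2.
  have := upper_END_tail X_rv XuE ui eps0 delta2.
  have := nbhs_infty_gt 0.
  apply: filterS3 => n n0 [xi [xiS xi0 xid xi1]] [zeta [zetaS zeta0 zetad zeta1]].
  have nr0 : 0 < n%:R :> R by rewrite ltr0n.
  (* Both majorants are nonnegative and each is at least [1] on its own event, so their sum
     dominates the union at cost [delta / 2] each. *)
  apply: (@le_trans _ _ (Ehat S (fun w => xi w + zeta w))); last first.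
    by rewrite [delta]splitr; exact: Ehat_add_le.
  apply: upper_capacity_le => [|w|w]; [exact: rv_add|exact: addr_ge0|].
  case=> /=.
  (* As the conjugate expectation of [X_i] is [- E[- X_i]], this event is an upper tail event of
     [- X_i]. *)
  - rewrite lte_pdivrMl // (_ : (\sum_(i < n) _)%E =
      (- \sum_(i < n) (- X i w - fine (Ehat S (fun w => - X i w))))%:E).
      rewrite -EFinM lte_fin mulrN ltrN2 => /ltW/zeta1.
      by move=> h; rewrite ler_wpDl.
    rewrite -sumrN -sumEFin; apply: eq_bigr => i _.
    by rewrite /conj_expectation -{1}(fineK (NEfin i)) oppeK -EFinD; congr EFin; ring.
  - rewrite lte_pdivlMl // (_ : (\sum_(i < n) _)%E =
      (\sum_(i < n) (X i w - fine (Ehat S (X i))))%:E).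
      rewrite -EFinM lte_fin => /ltW/xi1.
      by move=> h; rewrite ler_wpDr.
    rewrite -sumEFin; apply: eq_bigr => i _.
    by rewrite -{1}(fineK (Efin i)) -EFinB.
split=> // mu_up mu_low Emu cEmu eps eps0.
(* With [1] written as [1 - 0], it remains to show that the upper capacity of the complement tends
   to [0]. *)
rewrite -[X in _ --> X](sube0 1%E).
apply: cvgeB => //; first exact: cvg_cst.
apply: (squeeze_cvge _ (cvg_cst 0%E) (weak_law eps eps0)).
have := nbhs_infty_gt 0; apply: filterS => n n0.
have nr0 : 0 < n%:R :> R by rewrite ltr0n.
(* With constant means and [n > 0], the complement lies in the union treated by [weak_law]. *)
rewrite upper_capacity_ge0 /=; apply: upper_capacity_mono => w /=.
have sumE (e : nat -> \bar R) (mu : R) : (forall i, e i = mu%:E) ->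
    (\sum_(i < n) ((X i w)%:E - e i))%E = (\sum_(i < n) X i w - n%:R * mu)%:E.
  move=> emu; under eq_bigr do rewrite emu -EFinB.
  by rewrite sumEFin sumrB sumr_const card_ord -[mu *+ n]mulr_natl.
rewrite (sumE _ _ Emu) (sumE (fun i => conj_expectation S (X i)) _ cEmu).
rewrite lte_pdivrMl // lte_pdivlMl // -!EFinM !lte_fin.
move=> /negP; rewrite negb_and -!ltNge ltr_pdivrMr // ltr_pdivlMr //.
by move=> /orP[h|h]; [left|right]; lra.
Qed.
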